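(* Let $\Omega\subset\mathbb{R}^d$ be open and let $\nu:\mathbb{R}^d\setminus\{0\}\to[0,\infty)$ be a symmetric Lévy density with full support. Let $B\subset\Omega$ be nonempty and open, and let $\widetilde\nu(x)=\int_B(1\wedge\nu(x-y))\,dy$, $x\in\mathbb{R}^d$. (i) $\widetilde\nu\in L^\infty(\mathbb{R}^d)$. Moreover, if $|B|<\infty$, then $\widetilde\nu\in L^1(\mathbb{R}^d)$. (ii) The embedding $V_\nu(\Omega|\mathbb{R}^d)\hookrightarrow L^2(\mathbb{R}^d,\widetilde\nu)$ is continuous. If $|B|<\infty$, then the embedding $L^2(\mathbb{R}^d,\widetilde\nu)\hookrightarrow L^1(\mathbb{R}^d,\widetilde\nu)$ is continuous. (iii) If $\nu$ is unimodal and $B$ is bounded, then on $V_\nu(\Omega|\mathbb{R}^d)$ the norms $\|\cdot\|^{\#}$ and $\|\cdot\|^{*}$ are equivalent, where $$\|u\|^{*2}=\int_{\mathbb{R}^d}|u(x)|^2\widetilde\nu(x)\,dx+\iint_{(\Omega^c\times\Omega^c)^c}(u(x)-u(y))^2\nu(x-y)\,dx\,dy,$$ $$\|u\|^{\#2}=\int_{\Omega}|u(x)|^2\widetilde\nu(x)\,dx+\iint_{(\Omega^c\times\Omega^c)^c}(u(x)-u(y))^2\nu(x-y)\,dx\,dy.$$ Furthermore, if $\Omega$ is bounded, then the norms $\|\cdot\|_{V_\nu(\Omega|\mathbb{R}^d)}$ and $\|\cdot\|^{*}$ are also equivalent on $V_\nu(\Omega|\mathbb{R}^d)$.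
   Context: A symmetric Lévy density is a measurable $\nu:\mathbb{R}^d\setminus\{0\}\to[0,\infty)$ with $\nu(h)=\nu(-h)$ and $\int_{\mathbb{R}^d}(1\wedge|h|^2)\nu(h)\,dh<\infty$. Full support: the support of the measure $\nu(h)\,dh$ is all of $\mathbb{R}^d$. $\nu$ is unimodal if it is radial with almost decreasing profile: there is $c\ge1$ with $\nu(r)\le c\,\nu(s)$ for all $0<s\le r$. $V_\nu(\Omega|\mathbb{R}^d)$ is the space of (a.e.-classes of) measurable $u:\mathbb{R}^d\to\mathbb{R}$ with $u|_\Omega\in L^2(\Omega)$ and $|u|^2_{V_\nu(\Omega|\mathbb{R}^d)}=\int_\Omega\int_{\mathbb{R}^d}(u(x)-u(y))^2\nu(x-y)\,dy\,dx<\infty$, normed by $\|u\|^2_{V_\nu(\Omega|\mathbb{R}^d)}=\|u\|^2_{L^2(\Omega)}+|u|^2_{V_\nu(\Omega|\mathbb{R}^d)}$. $(\Omega^c\times\Omega^c)^c$ is the complement of $\Omega^c\times\Omega^c$ in $\mathbb{R}^d\times\mathbb{R}^d$. $L^p(\mathbb{R}^d,\widetilde\nu)$ is the $L^p$-space for the measure $\widetilde\nu(x)\,dx$. *)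

(* Defs.v *)
From HB Require Import structures.
From mathcomp Require Import all_boot all_order all_algebra.
From mathcomp Require Import all_classical all_reals all_analysis.
From mathcomp Require Import measurable_realfun.

Set Implicit Arguments.
Unset Strict Implicit.
Unset Printing Implicit Defensive.

Import Order.TTheory GRing.Theory Num.Theory.
Import numFieldNormedType.Exports.

Local Open Scope classical_set_scope.
Local Open Scope ring_scope.

(** * R^d as a measurable space

   R^d is ['rV[R]_d] with its library topology.  Its sigma-algebra is the one
   generated by the coordinates; [measurable_rVE] below identifies it with the
   Borel sigma-algebra. *)

Definition rV_display : measure_display -> measure_display.
Proof. exact. Qed.

Section measurable_rV.
Context (R : realType) (n : nat).

Definition rV_coord (i : 'I_n) (x : 'rV[R]_n) : R := x ord0 i.

Let rV_set0 : g_sigma_preimage rV_coord set0.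
Proof. exact: sigma_algebra0. Qed.

Let rV_setC A : g_sigma_preimage rV_coord A -> g_sigma_preimage rV_coord (~` A).
Proof. exact: sigma_algebraC. Qed.

Let rV_bigcup (F : (set 'rV[R]_n)^nat) :
  (forall i, g_sigma_preimage rV_coord (F i)) ->
  g_sigma_preimage rV_coord (\bigcup_i (F i)).
Proof. exact: sigma_algebra_bigcup. Qed.

HB.instance Definition _ :=
  @isMeasurable.Build (rV_display default_measure_display) 'rV[R]_n
    (g_sigma_preimage rV_coord) rV_set0 rV_setC rV_bigcup.

Lemma measurable_rV_coord (i : 'I_n) : measurable_fun [set: 'rV[R]_n] (rV_coord i).
Proof.
move=> _ Y mY; rewrite setTI; apply: sub_sigma_algebra => /=.
rewrite -bigcup_seq/=; exists i => /=; first by rewrite mem_index_enum.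
by exists Y => //; rewrite setTI.
Qed.

Lemma measurable_fun_rVP d (T : measurableType d) (f : T -> 'rV[R]_n) :
  measurable_fun [set: T] f <->
  forall i, measurable_fun [set: T] (rV_coord i \o f).
Proof.
split=> [mf i|mf]; first exact: measurableT_comp (measurable_rV_coord i) mf.
move=> _ A mA; rewrite setTI.
suff : g_sigma_preimage rV_coord `<=` [set B | measurable (f @^-1` B)] by exact.
apply: smallest_sub => [|B].
  split=> /= [|B mB|F mF].
  - by rewrite preimage_set0; exact: measurable0.
  - by rewrite setTD preimage_setC; exact: measurableC.
  - by rewrite preimage_bigcup; exact: bigcupT_measurable.
rewrite -bigcup_seq => -[i _ [C mC <-]]; rewrite setTI /=.
by have := mf i measurableT C mC; rewrite setTI.
Qed.

Lemma measurable_rVE : (measurable : set (set 'rV[R]_n)) = <<s open >>.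
Proof.
apply/seteqP; split.
  apply: smallest_sub => [|B]; first exact: smallest_sigma_algebra.
  rewrite -bigcup_seq => -[i _ [C mC <-]]; rewrite setTI /=.
  have : <<s open >> `<=` [set A : set R | <<s open >> (rV_coord i @^-1` A)].
    apply: smallest_sub => [|A oA] /=.
      have [s0 sC sU] := @smallest_sigma_algebra _ setT (@open 'rV[R]_n).
      split=> /= [|A|F].
      - by rewrite preimage_set0.
      - by move=> /sC; rewrite !setTD preimage_setC.
      - by move=> /sU; rewrite preimage_bigcup.
    apply: sub_sigma_algebra; apply: open_comp => // x _.
    exact: coord_continuous.
  apply; move: mC; rewrite [X in X C -> _](@RGenOpens.measurableE R).
  apply: sub_smallest2r; first exact: smallest_sigma_algebra.
  by move=> _ [x [y ->]]; exact: interval_open.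
apply: smallest_sub => [|U oU]; first exact: sigma_algebra_measurable.
pose Q (p : 'rV[rat]_n * nat) : set 'rV[R]_n :=
  \bigcap_(i in [set: 'I_n])
    (rV_coord i @^-1` ball (ratr (p.1 ord0 i) : R) (p.2.+1%:R^-1)).
have mQ p : measurable (Q p).
  apply: fin_bigcap_measurable => // i _; rewrite -[X in measurable X]setTI.
  by apply: measurable_rV_coord => //; exact: measurable_ball.
suff -> : U = \bigcup_(p in [set p | Q p `<=` U]) Q p.
  rewrite bigcup_mkcond; apply: countable_bigcupT_measurable => // p.
  by case: ifP => // _; exact: measurable0.
apply/seteqP; split=> [x Ux|x [p pU /pU]//].
have [_/posnumP[e] xeU] : exists2 e : R, 0 < e & ball x e `<=` U.
  exact/nbhs_ballP/open_nbhs_nbhs.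
have [k _ /(_ k (leqnn k)) /= ke] := near_infty_natSinv_lt (e%:num / 2)%:pos.
have q_ (i : 'I_n) : exists q : rat, ball (x ord0 i) (k.+1%:R^-1 : R) (ratr q).
  have k0 : 0 < k.+1%:R^-1 :> R by rewrite invr_gt0.
  have [r [xr [q _ qr]]] := @dense_rat R (ball (x ord0 i) (k.+1%:R^-1 : R))
    (ex_intro _ _ (ballxx _ k0)) (ball_open _ _).
  by exists q; rewrite qr.
pose q := fun i => projT1 (cid (q_ i)).
exists (\row_i q i, k) => [y Qy|i _] /=; last first.
  by rewrite mxE; apply: ball_sym; exact: (projT2 (cid (q_ i))).
apply: xeU; split => // i j; rewrite (ord1 i).
rewrite (_ : e%:num = e%:num / 2 + e%:num / 2 :> R); last exact: splitr.
apply: (@ball_triangle _ _ (ratr (q j) : R)).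
  by apply: le_ball (projT2 (cid (q_ j))); exact: ltW.
by move: (Qy j I); rewrite /= mxE; apply: le_ball; exact: ltW.
Qed.

End measurable_rV.

(** * Lebesgue measure on R^d

   [lebesgue_rV d] is the d-fold product of [lebesgue_measure] on R,
   transported to row vectors along [rV_cons]; [lebesgue_rV_box] computes it on
   boxes. *)

Section lebesgue_rV.
Context (R : realType).

Definition rV_cons n (p : R * 'rV[R]_n) : 'rV[R]_n.+1 := row_mx p.1%:M p.2.

Fixpoint lebesgue_rV n : set 'rV[R]_n -> \bar R :=
  match n with
  | 0 => dirac (0 : 'rV[R]_0)
  | m.+1 => pushforward (lebesgue_measure \x @lebesgue_rV m)%E (@rV_cons m)
  end.

Lemma rV_cons0 n (p : R * 'rV[R]_n) : rV_cons p ord0 ord0 = p.1.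
Proof.
rewrite /rV_cons (_ : @ord0 n = lshift n (@ord0 0)); last exact/val_inj.
by rewrite (@row_mxEl _ 1 1 n) mxE.
Qed.

Lemma rV_consS n (p : R * 'rV[R]_n) i : rV_cons p ord0 (lift ord0 i) = p.2 ord0 i.
Proof.
rewrite /rV_cons (_ : lift ord0 i = rshift 1 i); last exact/val_inj.
by rewrite (@row_mxEr _ 1 1 n).
Qed.

Lemma measurable_rV_cons n : measurable_fun setT (@rV_cons n).
Proof.
apply/measurable_fun_rVP => i; have [->|i0] := eqVneq i ord0.
  by rewrite (_ : _ \o _ = fst)//; apply/funext => p; exact: rV_cons0.
case: (unliftP ord0 i) i0 => [j ->{i} _|->]; last by rewrite eqxx.
rewrite (_ : _ \o _ = rV_coord j \o snd).
  exact: measurableT_comp (measurable_rV_coord j) measurable_snd.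
by apply/funext => p; exact: rV_consS.
Qed.

Section step.
Context n (mu : {sigma_finite_measure set 'rV[R]_n -> \bar R}).

Let step : set 'rV[R]_n.+1 -> \bar R :=
  pushforward (lebesgue_measure \x mu)%E (@rV_cons n).

Let mpre A : measurable A -> measurable (@rV_cons n @^-1` A).
Proof. by rewrite -[X in _ -> measurable X]setTI; exact: measurable_rV_cons. Qed.

Let step0 : step set0 = 0%E.
Proof. by rewrite /step /pushforward preimage_set0 measure0. Qed.

Let step_ge0 A : (0 <= step A)%E.
Proof. exact: (measure_ge0 (lebesgue_measure \x mu)%E). Qed.

Let step_sigma_additive : semi_sigma_additive step.
Proof.
move=> F mF tF mUF; rewrite /step /pushforward preimage_bigcup.
apply: measure_semi_sigma_additive.
- by move=> i; exact: mpre.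
- apply/trivIsetP => /= i j _ _ ij; rewrite -preimage_setI.
  by move/trivIsetP : tF => /(_ _ _ _ _ ij) ->//; rewrite preimage_set0.
- by rewrite -preimage_bigcup; exact: mpre.
Qed.

#[local] HB.instance Definition _ :=
  isMeasure.Build _ _ _ step step0 step_ge0 step_sigma_additive.

Let step_sigma_finite : sigma_finite setT step.
Proof.
have /sigma_finiteP[F [FT ndF mF]] := sigma_finiteT (@lebesgue_measure R).
have /sigma_finiteP[G [GT ndG mG]] := sigma_finiteT mu.
pose cons_inv (x : 'rV[R]_n.+1) : R * 'rV[R]_n :=
  (x ord0 ord0, \row_i x ord0 (lift ord0 i)).
have consK : cancel (@rV_cons n) cons_inv.
  move=> [r x]; rewrite /cons_inv rV_cons0; congr pair.
  by apply/rowP => i; rewrite mxE rV_consS.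
have minv : measurable_fun setT cons_inv.
  apply/measurable_fun_pairP; split.
    exact: (measurable_rV_coord ord0).
  apply/measurable_fun_rVP => i.
  rewrite (_ : _ \o _ = rV_coord (lift ord0 i)); first exact: measurable_rV_coord.
  by apply/funext => x /=; rewrite /rV_coord /= mxE.
exists (fun k => cons_inv @^-1` (F k `*` G k)).
  rewrite -preimage_bigcup; apply/seteqP; split => // x _ /=.
  have [[i _ Fi] [j _ Gj]] : (\bigcup_k F k) (cons_inv x).1 /\
      (\bigcup_k G k) (cons_inv x).2 by rewrite -FT -GT.
  exists (maxn i j) => //; split.
    by move: Fi; exact/subsetPset/ndF/leq_maxl.
  by move: Gj; exact/subsetPset/ndG/leq_maxr.
move=> k; have [mFk Fk] := mF k; have [mGk Gk] := mG k; split.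
  rewrite -[X in measurable X]setTI; apply: minv => //; exact: measurableX.
rewrite /step /pushforward -comp_preimage (_ : cons_inv \o _ = id); last first.
  by apply/funext => p; exact: consK.
by rewrite preimage_id product_measure1E// lte_mul_pinfty// ge0_fin_numE.
Qed.

#[local] HB.instance Definition _ :=
  Measure_isSigmaFinite.Build _ _ _ step step_sigma_finite.

Lemma lebesgue_rV_step : exists m : {sigma_finite_measure set 'rV[R]_n.+1 -> \bar R},
  (m : set _ -> _) = pushforward (lebesgue_measure \x mu)%E (@rV_cons n).
Proof. by exists step. Qed.

End step.

Lemma lebesgue_rV_measure n :
  exists m : {sigma_finite_measure set 'rV[R]_n -> \bar R},
    (m : set _ -> _) = @lebesgue_rV n.
Proof.
elim: n => [|n [m mE]]; last by rewrite /= -mE; exact: lebesgue_rV_step.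
by exists (dirac (0 : 'rV[R]_0)).
Qed.

Let lebesgue_rV0 n : @lebesgue_rV n set0 = 0%E.
Proof. by have [m <-] := lebesgue_rV_measure n; rewrite measure0. Qed.

Let lebesgue_rV_ge0 n A : (0 <= @lebesgue_rV n A)%E.
Proof. by have [m <-] := lebesgue_rV_measure n; exact: measure_ge0. Qed.

Let lebesgue_rV_semi_sigma_additive n : semi_sigma_additive (@lebesgue_rV n).
Proof.
by have [m <-] := lebesgue_rV_measure n; exact: measure_semi_sigma_additive.
Qed.

HB.instance Definition _ n := isMeasure.Build _ _ _ (@lebesgue_rV n)
  (@lebesgue_rV0 n) (@lebesgue_rV_ge0 n) (@lebesgue_rV_semi_sigma_additive n).

Let lebesgue_rV_sigma_finite n : sigma_finite setT (@lebesgue_rV n).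
Proof. by have [m <-] := lebesgue_rV_measure n; exact: sigma_finiteT. Qed.

HB.instance Definition _ n := Measure_isSigmaFinite.Build _ _ _ (@lebesgue_rV n)
  (@lebesgue_rV_sigma_finite n).

Lemma lebesgue_rV_box n (a b : 'rV[R]_n) : (forall i, a ord0 i <= b ord0 i) ->
  lebesgue_rV [set x : 'rV[R]_n | forall i, a ord0 i <= x ord0 i <= b ord0 i] =
  (\prod_i (b ord0 i - a ord0 i))%:E.
Proof.
elim: n a b => [|n IH] a b ab.
  rewrite big_ord0 /= diracE mem_set//= => i; by case: i.
pose a' : 'rV[R]_n := \row_i a ord0 (lift ord0 i).
pose b' : 'rV[R]_n := \row_i b ord0 (lift ord0 i).
have consE : @rV_cons n @^-1`
      [set x : 'rV[R]_n.+1 | forall i, a ord0 i <= x ord0 i <= b ord0 i] =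
    `[a ord0 ord0, b ord0 ord0]%classic `*`
      [set x : 'rV[R]_n | forall i, a' ord0 i <= x ord0 i <= b' ord0 i].
  apply/seteqP; split => p /=.
    move=> abp; split.
      by have := abp ord0; rewrite rV_cons0 in_itv.
    by move=> i; have := abp (lift ord0 i); rewrite rV_consS !mxE.
  move=> [p1 p2] i; case: (unliftP ord0 i) => [j ->|->].
    by have := p2 j; rewrite rV_consS !mxE.
  by rewrite rV_cons0; rewrite in_itv in p1.
rewrite /= /pushforward consE product_measure1E//; last first.
  rewrite (_ : [set x : 'rV[R]_n | _] = \bigcap_(i in [set: 'I_n])
    (rV_coord i @^-1` `[a' ord0 i, b' ord0 i])); last first.
    apply/seteqP; split => x /= xab i; first by move=> _; rewrite /= in_itv; exact: xab.
    by have := xab i I; rewrite /= in_itv.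
  apply: fin_bigcap_measurable => // i _; rewrite -[X in measurable X]setTI.
  by apply: measurable_rV_coord.
have a'b' i : a' ord0 i <= b' ord0 i by rewrite !mxE.
have itvE : lebesgue_measure `[a ord0 ord0, b ord0 ord0]%classic =
    (b ord0 ord0 - a ord0 ord0)%:E.
  rewrite lebesgue_measure_itv/= lte_fin; case: ifPn => [_|]; first by rewrite -EFinB.
  by rewrite -leNgt => ba; rewrite (@le_anti _ _ (b ord0 ord0) (a ord0 ord0)) ?subrr// ba ab.
rewrite [X in (X * _)%E]itvE [X in (_ * X)%E](IH _ _ a'b') -EFinM big_ord_recl.
by congr (_ * _)%:E; apply: eq_bigr => i _; rewrite !mxE.
Qed.

End lebesgue_rV.

(** * Lévy densities, the space V_nu(Omega|R^d) and the norms *)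

(** Euclidean norm; the library norm [`|x|] on ['rV[R]_d] is the sup norm. *)
Definition enorm (R : realType) d (x : 'rV[R]_d) : R :=
  Num.sqrt (\sum_i x ord0 i ^+ 2).

Section levy.
Context (R : realType) (d : nat).
Implicit Types (nu : 'rV[R]_d -> R) (u : 'rV[R]_d -> R) (Omega B : set 'rV[R]_d).
Implicit Types (w : 'rV[R]_d -> \bar R).

Local Notation leb := (@lebesgue_rV R d).

(** A density on R^d \ {0} is a total function [nu] on R^d about whose value at
    [0] nothing is assumed; since [d > 0] in the theorem, [0] is Lebesgue-null. *)

Record symmetric_levy_density nu : Prop := SymmetricLevyDensity {
  levy_measurable : measurable_fun [set~ (0 : 'rV[R]_d)] nu;
  levy_ge0 : forall h, h != 0 -> 0 <= nu h;
  levy_sym : forall h, h != 0 -> nu h = nu (- h);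
  levy_integrable :
    (\int[leb]_(h in [set~ (0%R : 'rV[R]_d)]) (Num.min 1 (enorm h ^+ 2) * nu h)%:E < +oo)%E
}.

Definition msupport (m : set 'rV[R]_d -> \bar R) : set 'rV[R]_d :=
  [set x | forall U, open U -> U x -> (0 < m U)%E].

Definition density_measure nu (A : set 'rV[R]_d) : \bar R :=
  (\int[leb]_(h in A `\ (0%R : 'rV[R]_d)) (nu h)%:E)%E.

Definition full_support nu : Prop := msupport (density_measure nu) = setT.

Definition unimodal nu : Prop :=
  exists profile : R -> R,
    (forall h, h != 0 -> nu h = profile (enorm h)) /\
    (exists2 c : R, 1 <= c &
       forall s r, 0 < s -> s <= r -> profile r <= c * profile s).

Definition nutilde nu B (x : 'rV[R]_d) : \bar R :=
  (\int[leb]_(y in B) (Num.min 1 (nu (x - y)%R))%:E)%E.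

Definition mem_Lp (p : \bar R) w : Prop :=
  measurable_fun setT w /\ ('N[leb]_p[w] < +oo)%E.

(** Spaces of a.e.-classes are represented by sets of functions with a norm that
    vanishes exactly on the functions in the zero class. *)

Definition L2_norm2 Omega u : \bar R :=
  (\int[leb]_(x in Omega) (`|u x| ^+ 2)%:E)%E.

Definition V_seminorm2 nu Omega u : \bar R :=
  (\int[leb]_(x in Omega) \int[leb]_y ((u x - u y) ^+ 2 * nu (x - y)%R)%:E)%E.

Definition V_space nu Omega : set ('rV[R]_d -> R) :=
  [set u | [/\ measurable_fun setT u, (L2_norm2 Omega u < +oo)%E
             & (V_seminorm2 nu Omega u < +oo)%E]].

Definition V_norm nu Omega u : \bar R :=
  sqrte (L2_norm2 Omega u + V_seminorm2 nu Omega u)%E.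

(** L^p of the measure w(x)dx. *)
Definition wLp_norm (p : R) w u : \bar R :=
  ((\int[leb]_x ((`|u x| `^ p)%:E * w x)) `^ p^-1)%E.

Definition wLp_space (p : R) w : set ('rV[R]_d -> R) :=
  [set u | measurable_fun setT u /\ (wLp_norm p w u < +oo)%E].

Definition offdiag_energy nu Omega u : \bar R :=
  (\int[leb \x leb]_(z in ~` ((~` Omega) `*` (~` Omega)))
     ((u z.1 - u z.2) ^+ 2 * nu (z.1 - z.2)%R)%:E)%E.

Definition star_norm nu B Omega u : \bar R :=
  sqrte (\int[leb]_x ((`|u x| ^+ 2)%:E * nutilde nu B x)
         + offdiag_energy nu Omega u)%E.

Definition sharp_norm nu B Omega u : \bar R :=
  sqrte (\int[leb]_(x in Omega) ((`|u x| ^+ 2)%:E * nutilde nu B x)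
         + offdiag_energy nu Omega u)%E.

End levy.

Section norms.
Context (R : realType) (X : Type).
Implicit Types (E F : set X) (NE NF : X -> \bar R).

(** For linear [E], [F] the second clause says that the inclusion is injective
    on classes. *)
Definition continuous_embedding E NE F NF : Prop :=
  [/\ E `<=` F,
      forall u, E u -> NF u = 0%E -> NE u = 0%E
    & exists2 C : R, 0 < C & forall u, E u -> (NF u <= C%:E * NE u)%E].

Definition equivalent_norms E (N1 N2 : X -> \bar R) : Prop :=
  (forall u, E u -> (N1 u < +oo)%E /\ (N2 u < +oo)%E) /\
  exists c C : R, [/\ 0 < c, 0 < C &
    forall u, E u -> (c%:E * N1 u <= N2 u)%E /\ (N2 u <= C%:E * N1 u)%E].

End norms.

(* Main.v *)
From HB Require Import structures.
Require Import Defs.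
From mathcomp Require Import all_boot all_order all_algebra.
From mathcomp Require Import all_classical all_reals all_analysis.
From mathcomp Require Import measurable_realfun ess_sup_inf lra.

(** Write m = 1 /\ nu for the truncated density, so that the weight is the
    convolution nutilde(x) = \int_B m(x - y) dy.

    The function m is integrable: it is at most 1 on the unit ball, and off the
    unit ball it is at most (1 /\ |h|^2) nu(h).  Hence nutilde is bounded by the
    total mass M of m, and by Tonelli its integral is |B| M
    ([nutilde_le_mass], [integral_nutilde]).

    The main estimate [weighted_L2_le] integrates the pointwise inequality
      u(x)^2 <= 2 u(y)^2 + 2 (u(x) - u(y))^2
    against m(x - y) dx dy over y in B: the first term gives 2 M |u|^2 in
    L^2(B), and since m <= nu the second is at most twice the energy.  This
    bounds the weighted L^2 norm by the norm of V.  The embedding of weighted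
    L^2 into weighted L^1 is the Cauchy-Schwarz inequality for the finite
    measure nutilde(x) dx.  Both embeddings are injective on classes because
    nutilde > 0, so that a null function for the weight is null for Lebesgue
    measure.

    The norm equivalences rest on [nutilde_bounded_ge]: nutilde is bounded below
    by a positive constant on every bounded set.  If B contains the ball of
    radius e about b, then for x within e/2 of x0 the weight nutilde(x) is at
    least the integral of m over the ball of radius e/2 about b - x0, a bound
    which depends on x0 only and is positive because nu has full support;
    compactness makes it uniform.  So on bounded sets the unweighted L^2 norm is
    controlled by the weighted one.  On B this closes the main estimate in terms
    of the norm #; on a bounded Omega it bounds the norm of V by the norm *.
    Finally, the energies over Omega x R^d and over the complement of
    Omega^c x Omega^c differ by a factor of at most 2.

    Nothing is known about nu(0), so all estimates are carried out for the
    density set to 0 at the origin, which is nonnegative and symmetric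
    everywhere and yields the same weight and the same energies. *)

Set Implicit Arguments.
Unset Strict Implicit.
Unset Printing Implicit Defensive.

Import Order.TTheory GRing.Theory Num.Theory.
Import numFieldNormedType.Exports.
Local Open Scope classical_set_scope.
Local Open Scope ring_scope.

(** * Translation invariance of Lebesgue measure on R^d *)

Lemma lebesgue_measure_translate (R : realType) (a : R) (A : set R) :
  measurable A -> lebesgue_measure ((fun x => x + a) @^-1` A) = lebesgue_measure A.
Proof.
have ma : measurable_fun setT ((fun x => x + a) : measurableTypeR R -> measurableTypeR R).
  exact: measurable_funD.
move=> mA; apply/esym.
pose mf := isMeasurableFun.Build _ _ _ _ _ ma.
pose f : {mfun measurableTypeR R >-> measurableTypeR R} := HB.pack (fun x : R => x + a) mf.
apply: (lebesgue_measure_unique (mu := pushforward lebesgue_measure f)) => //= _ [[b c]] _ <-.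
rewrite /pushforward /= (_ : f @^-1` _ = `](b - a), (c - a)]%classic); last first.
  by apply/seteqP; split => x /=; rewrite !in_itv/= ltrBlDr lerBrDr.
by rewrite !lebesgue_measure_itv/= !lte_fin ltrD2r -!EFinB opprD opprK addrACA addNr addr0.
Qed.

Section lebesgue_rV.
Context (R : realType) (d : nat).
Local Notation leb := (@lebesgue_rV R d).

Lemma measurable_rV_sub :
  measurable_fun setT (fun z : 'rV[R]_d * 'rV[R]_d => z.1 - z.2).
Proof.
apply/measurable_fun_rVP => i.
rewrite (_ : _ \o _ = fun z => rV_coord i z.1 - rV_coord i z.2); last first.
  by apply/funext => z /=; rewrite /rV_coord !mxE.
by apply: measurable_funB; apply: (measurableT_comp (measurable_rV_coord i)).
Qed.

Lemma measurable_rV_add (a : 'rV[R]_d) : measurable_fun setT (fun x : 'rV[R]_d => x + a).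
Proof.
apply/measurable_fun_rVP => i.
rewrite (_ : _ \o _ = fun x => rV_coord i x + rV_coord i a); last first.
  by apply/funext => z /=; rewrite /rV_coord !mxE.
by apply: measurable_funD => //; exact: measurable_rV_coord.
Qed.

Lemma open_measurable_rV (A : set 'rV[R]_d) : open A -> measurable A.
Proof. by move=> oA; rewrite measurable_rVE; exact: sub_sigma_algebra. Qed.

Lemma measurable_rV_set1 (x : 'rV[R]_d) : measurable [set x].
Proof.
rewrite -(setCK [set x]); apply: measurableC; apply: open_measurable_rV.
by apply: closed_openC; apply: accessible_closed_set1; exact: hausdorff_accessible.
Qed.

Lemma lebesgue_rV_set1 (x : 'rV[R]_d) : (0 < d)%N -> leb [set x] = 0%E.
Proof.
move=> d0; rewrite (_ : [set x] =
   [set y : 'rV[R]_d | forall i, x ord0 i <= y ord0 i <= x ord0 i]); last first.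
  apply/seteqP; split => [y -> //= i|y /= xy]; first by rewrite lexx.
  by apply/rowP => i; apply/esym/le_anti.
rewrite lebesgue_rV_box//; case: (d) d0 x => // n _ x.
by rewrite big_ord_recl subrr mul0r.
Qed.

Lemma lebesgue_rV_bounded (A : set 'rV[R]_d) :
  measurable A -> bounded_set A -> (leb A < +oo)%E.
Proof.
move=> mA [M [Mr AM]].
pose N := Num.max 0 (M + 1).
have N0 : 0 <= N by rewrite le_max lexx.
have AN y : A y -> `|y| <= N by apply: AM; rewrite lt_max ltrDl ltr01 orbT.
pose b : 'rV[R]_d := const_mx N.
have := @lebesgue_rV_box R d (- b) b.
move=> /(_ _)/(congr1 (fun x => (x < +oo)%E)); rewrite ltry => H.
apply: le_lt_trans (H _) => [|i]; last by rewrite !mxE; lra.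
apply: le_measure; rewrite ?inE//.
  rewrite (_ : [set x : 'rV[R]_d | _] = \bigcap_(i in [set: 'I_d])
    (rV_coord i @^-1` `[(- b) ord0 i, b ord0 i])); last first.
    apply/seteqP; split => x /= xab i; first by move=> _; rewrite /= in_itv; exact: xab.
    by have := xab i I; rewrite /= in_itv.
  apply: fin_bigcap_measurable => // i _; rewrite -[X in measurable X]setTI.
  by apply: measurable_rV_coord.
move=> y Ay i; rewrite !mxE -ler_norml.
apply: le_trans (AN y Ay); rewrite [leRHS]/Num.Def.normr /= mx_normrE.
by apply/bigmax_geP; right => /=; exists (ord0, i).
Qed.

End lebesgue_rV.

(** Induction on the dimension: the section at r of the translate of A is the
    translate of the section of A at the shifted first coordinate, so the
    product formula reduces the claim to invariance in lower dimension and to a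
    shift of the variable r on the line. *)
Lemma lebesgue_rV_translate (R : realType) d (a : 'rV[R]_d) (A : set 'rV[R]_d) :
  measurable A -> lebesgue_rV ((fun x => x + a) @^-1` A) = lebesgue_rV A.
Proof.
elim: d a A => [|n IH] a A mA.
  rewrite (_ : _ @^-1` A = A)//; apply/seteqP.
  by split => x /=; rewrite [a]thinmx0 addr0.
have mpre : measurable (@rV_cons R n @^-1` A).
  by rewrite -[X in measurable X]setTI; exact: measurable_rV_cons.
pose a' : 'rV[R]_n := \row_i a ord0 (lift ord0 i).
pose F r := lebesgue_rV (xsection (@rV_cons R n @^-1` A) r).
have cons_add r x : rV_cons (r + a ord0 ord0, x + a') = rV_cons (r, x) + a.
  apply/rowP => i; rewrite [RHS]mxE; case: (unliftP ord0 i) => [j ->|->].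
    by rewrite !rV_consS !mxE.
  by rewrite !rV_cons0.
have mF : measurable_fun setT (F : measurableTypeR R -> \bar R).
  exact: measurable_fun_xsection.
transitivity (\int[@lebesgue_measure R]_r F ((r : R) + a ord0 ord0)%R)%E.
  apply: eq_integral => r _; rewrite /F /=.
  rewrite -(IH a'); last exact: measurable_xsection.
  congr lebesgue_rV; apply/seteqP; split => x; rewrite /xsection /= !inE /=;
    by rewrite cons_add.
have ma : measurable_fun setT
    ((fun x => x + a ord0 ord0) : measurableTypeR R -> measurableTypeR R).
  exact: measurable_funD.
have := @ge0_integral_pushforward _ _ _ _ R _ ma (@lebesgue_measure R) setT F measurableT mF.
move=> /(_ _)/esym H.
apply: etrans (H _) _; first by move=> y _; exact: measure_ge0.
apply: eq_measure_integral => B mB _ /=.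
exact: lebesgue_measure_translate.
Qed.

Lemma ge0_integral_translate (R : realType) d (a : 'rV[R]_d) (f : 'rV[R]_d -> \bar R) :
  measurable_fun setT f -> (forall x, 0 <= f x)%E ->
  (\int[@lebesgue_rV R d]_x f (x + a)%R = \int[@lebesgue_rV R d]_x f x)%E.
Proof.
move=> mf f0.
have := @ge0_integral_pushforward _ _ _ _ R _ (measurable_rV_add a)
  (@lebesgue_rV R d) setT f measurableT mf.
move=> /(_ _)/esym H.
apply: etrans (H _) _; first by move=> y _.
apply: eq_measure_integral => [|ma B mB _]; first exact: measurable_rV_add.
exact: lebesgue_rV_translate.
Qed.

(** * Convolution with the truncated kernel, and energies *)

Lemma integral_restrict_indic d (T : measurableType d) (R : realType)
    (mu : {measure set T -> \bar R}) (A : set T) (f : T -> \bar R) :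
  (\int[mu]_(x in A) f x = \int[mu]_x ((\1_A x)%:E * f x))%E.
Proof.
rewrite integral_mkcond epatch_indic.
by apply: eq_integral => x _ /=; rewrite muleC.
Qed.

Section convolution.
Context (R : realType) (d : nat).
Local Notation leb := (@lebesgue_rV R d).
Local Open Scope ereal_scope.

Lemma measurable_fun_sub d' (T : measurableType d') (f : 'rV[R]_d -> T) :
  measurable_fun setT f ->
  measurable_fun setT (fun z : 'rV[R]_d * 'rV[R]_d => f (z.1 - z.2)%R).
Proof. by move=> mf; exact: measurableT_comp (@measurable_rV_sub R d). Qed.

(** Tonelli and translation invariance; this single identity gives both the
    integral of the weight and the first term of the main estimate. *)
Lemma ge0_integral_convolution (f g : 'rV[R]_d -> \bar R) :
  measurable_fun setT f -> measurable_fun setT g ->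
  (forall x, 0 <= f x) -> (forall x, 0 <= g x) ->
  \int[leb \x leb]_z (g z.2 * f (z.1 - z.2)%R) =
  \int[leb]_x g x * \int[leb]_x f x.
Proof.
move=> mf mg f0 g0.
rewrite fubini_tonelli2//; first last.
- by move=> z; exact: mule_ge0.
- by apply: emeasurable_funM; [exact: measurableT_comp|exact: measurable_fun_sub].
rewrite -ge0_integralZr//; last exact: integral_ge0.
apply: eq_integral => y _; rewrite /fubini_G /= ge0_integralZl//.
  by rewrite (ge0_integral_translate (- y)%R mf).
exact: measurableT_comp mf (measurable_rV_add (- y)%R).
Qed.

End convolution.

Section kernel.
Context (R : realType) (d : nat) (k : 'rV[R]_d -> R).
Hypothesis mk : measurable_fun setT k.
Hypothesis k0 : forall h, 0 <= k h.
Hypothesis ksym : forall h, k (- h) = k h.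
Local Notation leb := (@lebesgue_rV R d).
Implicit Types (u : 'rV[R]_d -> R) (A B Omega : set 'rV[R]_d).

Local Open Scope ereal_scope.

Definition trunc_kernel h : \bar R := (Num.min 1 (k h))%:E.
Definition trunc_mass := \int[leb]_h trunc_kernel h.
Definition energy u (z : 'rV[R]_d * 'rV[R]_d) : \bar R :=
  ((u z.1 - u z.2) ^+ 2 * k (z.1 - z.2)%R)%:E.

Lemma trunc_kernel_ge0 h : 0 <= trunc_kernel h.
Proof. by rewrite lee_fin le_min ler01 k0. Qed.

Lemma measurable_trunc_kernel : measurable_fun setT trunc_kernel.
Proof. by apply/measurable_EFinP; exact: measurable_minr. Qed.

Lemma energy_ge0 u z : 0 <= energy u z.
Proof. by rewrite lee_fin mulr_ge0// sqr_ge0. Qed.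

Lemma energy_sym u x y : energy u (x, y) = energy u (y, x).
Proof. by rewrite /energy /= -sqrrN opprB -[k (x - y)]ksym opprB. Qed.

Lemma measurable_energy u : measurable_fun setT u -> measurable_fun setT (energy u).
Proof.
move=> mu; apply/measurable_EFinP; apply: measurable_funM.
  by apply: measurable_funX; apply: measurable_funB; exact: measurableT_comp.
exact: measurable_fun_sub.
Qed.

Lemma nutilde_ge0 B x : 0 <= nutilde k B x.
Proof. by apply: integral_ge0 => y _; exact: trunc_kernel_ge0. Qed.

Lemma nutildeE B x :
  nutilde k B x = \int[leb]_y ((\1_B y)%:E * trunc_kernel (x - y)).
Proof. exact: integral_restrict_indic. Qed.

Lemma measurable_nutilde_integrand B : measurable B ->
  measurable_fun setT
    (fun z : 'rV[R]_d * 'rV[R]_d => (\1_B z.2)%:E * trunc_kernel (z.1 - z.2)).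
Proof.
move=> mB; apply: emeasurable_funM.
  apply/measurable_EFinP; apply: measurableT_comp => //; exact: measurable_indic.
exact: (measurable_fun_sub measurable_trunc_kernel).
Qed.

Lemma nutilde_integrand_ge0 B (z : 'rV[R]_d * 'rV[R]_d) :
  0 <= (\1_B z.2)%:E * trunc_kernel (z.1 - z.2).
Proof. by apply: mule_ge0; [rewrite lee_fin|exact: trunc_kernel_ge0]. Qed.

Lemma measurable_nutilde B : measurable B -> measurable_fun setT (nutilde k B).
Proof.
move=> mB; rewrite (_ : nutilde k B = fubini_F leb
    (fun z : 'rV[R]_d * 'rV[R]_d => (\1_B z.2)%:E * trunc_kernel (z.1 - z.2))); last first.
  by apply/funext => x; rewrite nutildeE.
apply: measurable_fun_fubini_tonelli_F; first exact: measurable_nutilde_integrand.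
exact: nutilde_integrand_ge0.
Qed.

Lemma trunc_kernelN h : trunc_kernel (- h) = trunc_kernel h.
Proof. by rewrite /trunc_kernel ksym. Qed.

Lemma measurable_trunc_translate a :
  measurable_fun setT (fun y : 'rV[R]_d => trunc_kernel (y - a)).
Proof.
exact: measurableT_comp measurable_trunc_kernel (measurable_rV_add (- a)%R).
Qed.

Lemma nutilde_le_mass B x : measurable B -> nutilde k B x <= trunc_mass.
Proof.
move=> mB; rewrite /trunc_mass.
rewrite -(ge0_integral_translate (- x)%R measurable_trunc_kernel trunc_kernel_ge0).
have E : nutilde k B x = \int[leb]_(y in B) trunc_kernel (y - x).
  by apply: eq_integral => y _; rewrite -trunc_kernelN opprB.
rewrite E; apply: ge0_subset_integral => //; last by move=> y _; exact: trunc_kernel_ge0.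
exact: measurable_trunc_translate.
Qed.

Lemma integral_nutilde B : measurable B ->
  \int[leb]_x nutilde k B x = leb B * trunc_mass.
Proof.
move=> mB; transitivity ((\int[leb]_x (\1_B x)%:E) * trunc_mass); last first.
  by rewrite integral_indic// setIT.
rewrite -ge0_integral_convolution//; last 3 first.
- exact: measurable_trunc_kernel.
- by apply/measurable_EFinP; exact: measurable_indic.
- exact: trunc_kernel_ge0.
rewrite fubini_tonelli1; first by apply: eq_integral => x _; rewrite nutildeE.
- exact: measurable_nutilde_integrand.
- exact: nutilde_integrand_ge0.
Qed.

(** The seminorm as an integral over pairs, where Tonelli applies; by symmetry
    of the energy the first or the second variable may be the one confined
    to B. *)
Lemma V_seminorm2E u B : measurable_fun setT u -> measurable B ->
  V_seminorm2 k B u = \int[leb \x leb]_z ((\1_B z.1)%:E * energy u z).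
Proof.
move=> mu mB; rewrite fubini_tonelli1; last 2 first.
- apply: emeasurable_funM; last exact: measurable_energy.
  by apply/measurable_EFinP; apply: measurableT_comp => //; exact: measurable_indic.
- by move=> z; apply: mule_ge0; [rewrite lee_fin|exact: energy_ge0].
rewrite [LHS]integral_restrict_indic; apply: eq_integral => x _.
rewrite /fubini_F/= ge0_integralZl//; last by move=> y _; exact: energy_ge0.
by apply: measurableT_comp; [exact: measurable_energy|exact: measurable_pair1].
Qed.

Lemma V_seminorm2E' u B : measurable_fun setT u -> measurable B ->
  V_seminorm2 k B u = \int[leb \x leb]_z ((\1_B z.2)%:E * energy u z).
Proof.
move=> mu mB; rewrite fubini_tonelli2; last 2 first.
- apply: emeasurable_funM; last exact: measurable_energy.
  by apply/measurable_EFinP; apply: measurableT_comp => //; exact: measurable_indic.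
- by move=> z; apply: mule_ge0; [rewrite lee_fin|exact: energy_ge0].
rewrite [LHS]integral_restrict_indic; apply: eq_integral => y _.
rewrite /fubini_G/= ge0_integralZl//; last by move=> x _; exact: energy_ge0.
  by congr (_ * _); apply: eq_integral => x _; exact: energy_sym.
by apply: measurableT_comp; [exact: measurable_energy|exact: measurable_pair2].
Qed.

(** The main estimate: u(x)^2 <= 2 u(y)^2 + 2 (u(x) - u(y))^2, weighted by the
    truncated kernel and integrated over all x and over y in B. *)
Lemma weighted_L2_le u B : measurable_fun setT u -> measurable B ->
  \int[leb]_x ((`|u x| ^+ 2)%:E * nutilde k B x) <=
  2%:E * (L2_norm2 B u * trunc_mass + V_seminorm2 k B u).
Proof.
move=> mu mB.
have mu2 : measurable_fun setT (fun x => (`|u x| ^+ 2)%:E).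
  by apply/measurable_EFinP; apply: measurable_funX; exact: measurableT_comp.
have mB1 : measurable_fun setT (fun z : 'rV[R]_d * 'rV[R]_d => (\1_B z.2 : R)%:E).
  by apply/measurable_EFinP; apply: measurableT_comp => //; exact: measurable_indic.
pose F z := (`|u z.1| ^+ 2)%:E * ((\1_B z.2)%:E * trunc_kernel (z.1 - z.2)).
pose G1 z := (\1_B z.2)%:E * (`|u z.2| ^+ 2)%:E * trunc_kernel (z.1 - z.2).
pose G2 z := (\1_B z.2)%:E * energy u z.
have mF : measurable_fun setT F.
  apply: emeasurable_funM; last exact: measurable_nutilde_integrand.
  exact: measurableT_comp mu2 measurable_fst.
have mG2 : measurable_fun setT G2.
  by apply: emeasurable_funM => //; exact: measurable_energy.
have mG1 : measurable_fun setT G1.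
  apply: emeasurable_funM; last exact: (measurable_fun_sub measurable_trunc_kernel).
  apply: emeasurable_funM => //; exact: measurableT_comp mu2 measurable_snd.
have F0 z : 0 <= F z.
  by apply: mule_ge0; [rewrite lee_fin|exact: nutilde_integrand_ge0].
have G10 z : 0 <= G1 z.
  by apply: mule_ge0; [rewrite -EFinM lee_fin mulr_ge0|exact: trunc_kernel_ge0].
have G20 z : 0 <= G2 z by apply: mule_ge0; [rewrite lee_fin|exact: energy_ge0].
have -> : \int[leb]_x ((`|u x| ^+ 2)%:E * nutilde k B x) = \int[leb \x leb]_z F z.
  rewrite fubini_tonelli1//; apply: eq_integral => x _.
  rewrite nutildeE /fubini_F /F /= ge0_integralZl//.
    exact: (measurableT_comp (measurable_nutilde_integrand mB) (measurable_pair1 x)).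
  by move=> y _; exact: (nutilde_integrand_ge0 B (x, y)).
have -> : L2_norm2 B u * trunc_mass = \int[leb \x leb]_z G1 z.
  rewrite /L2_norm2 integral_restrict_indic -ge0_integral_convolution//.
  - exact: measurable_trunc_kernel.
  - apply: emeasurable_funM => //; apply/measurable_EFinP; exact: measurable_indic.
  - exact: trunc_kernel_ge0.
have -> : V_seminorm2 k B u = \int[leb \x leb]_z G2 z by exact: V_seminorm2E'.
rewrite -ge0_integralD// -ge0_integralZl//; last 2 first.
- by apply: emeasurable_funD.
- by move=> z _; exact: adde_ge0.
apply: ge0_le_integral => //.
  by apply: measurable_funeM; apply: emeasurable_funD.
move=> z _; rewrite /F /G1 /G2 /energy /trunc_kernel indicE.
case: (z.2 \in B) => /=; last by rewrite !(mul0e, mule0, adde0).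
rewrite !mul1e -!EFinM lee_fin.
set a := u z.1; set b := u z.2; set c := k _; rewrite !real_normK ?num_real//.
have [c1 m0 mc] : [/\ true, 0 <= Num.min 1%R c & Num.min 1 c <= c]%R.
  by rewrite le_min ler01 k0 ge_min lexx orbT.
apply: (@le_trans _ _ (2 * (b ^+ 2 + (a - b) ^+ 2) * Num.min 1 c)%R).
  (* 2 b^2 + 2 (a - b)^2 - a^2 = (a - 2 b)^2 *)
  by apply: ler_wpM2r => //; have := sqr_ge0 (a - b - b); nra.
rewrite -mulrA ler_pM2l// mulrDl lerD2l; apply: ler_wpM2l => //; exact: sqr_ge0.
Qed.

Let offdiag Omega := ~` (~` Omega `*` ~` Omega).

Let measurable_offdiag Omega : measurable Omega -> measurable (offdiag Omega).
Proof. by move=> mO; apply: measurableC; apply: measurableX; exact: measurableC. Qed.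

Lemma offdiag_energyE u Omega :
  offdiag_energy k Omega u =
  \int[leb \x leb]_z ((\1_(offdiag Omega) z)%:E * energy u z).
Proof. exact: integral_restrict_indic. Qed.

Let measurable_restrict_energy u (A : set ('rV[R]_d * 'rV[R]_d)) :
  measurable_fun setT u -> measurable A ->
  measurable_fun setT (fun z => (\1_A z)%:E * energy u z).
Proof.
move=> mu mA; apply: emeasurable_funM; last exact: measurable_energy.
by apply/measurable_EFinP; exact: measurable_indic.
Qed.

Let restrict_energy_ge0 u (r : R) z : (0 <= r)%R -> 0 <= r%:E * energy u z.
Proof. by move=> r0; apply: mule_ge0; [rewrite lee_fin|exact: energy_ge0]. Qed.

Lemma V_seminorm2_le_offdiag u Omega : measurable_fun setT u -> measurable Omega ->
  V_seminorm2 k Omega u <= offdiag_energy k Omega u.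
Proof.
move=> mu mO; rewrite V_seminorm2E// offdiag_energyE.
apply: ge0_le_integral => // [z _|||z _]; first exact: restrict_energy_ge0.
- apply: emeasurable_funM; last exact: measurable_energy.
  by apply/measurable_EFinP; apply: measurableT_comp => //; exact: measurable_indic.
- by apply: measurable_restrict_energy => //; exact: measurable_offdiag.
- apply: lee_wpmul2r; first exact: energy_ge0.
  rewrite lee_fin !indicE ler_nat; have [zO|//] := boolP (z.1 \in Omega).
  by rewrite mem_set//= => -[nz _]; apply: nz; rewrite inE in zO.
Qed.

(** A pair outside Omega^c x Omega^c has its first or its second entry in Omega,
    and by symmetry of the energy each of the two cases contributes at most the
    seminorm. *)
Lemma offdiag_le_V_seminorm2 u Omega : measurable_fun setT u -> measurable Omega ->
  offdiag_energy k Omega u <= 2%:E * V_seminorm2 k Omega u.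
Proof.
move=> mu mO.
have mO1 : measurable_fun setT
    (fun z : 'rV[R]_d * 'rV[R]_d => (\1_Omega z.1)%:E * energy u z).
  apply: emeasurable_funM; last exact: measurable_energy.
  by apply/measurable_EFinP; apply: measurableT_comp => //; exact: measurable_indic.
have mO2 : measurable_fun setT
    (fun z : 'rV[R]_d * 'rV[R]_d => (\1_Omega z.2)%:E * energy u z).
  apply: emeasurable_funM; last exact: measurable_energy.
  by apply/measurable_EFinP; apply: measurableT_comp => //; exact: measurable_indic.
rewrite mule_natl mule2n {1}V_seminorm2E// V_seminorm2E'// offdiag_energyE.
rewrite -ge0_integralD//; last 2 first.
- by move=> z _; exact: restrict_energy_ge0.
- by move=> z _; exact: restrict_energy_ge0.
apply: ge0_le_integral => // [z _|||z _]; first exact: restrict_energy_ge0.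
- by apply: measurable_restrict_energy => //; exact: measurable_offdiag.
- by apply: emeasurable_funD.
- rewrite -ge0_muleDl; [|by rewrite lee_fin|by rewrite lee_fin].
  apply: lee_wpmul2r; first exact: energy_ge0.
  rewrite -EFinD lee_fin !indicE -natrD ler_nat.
  have [z1|z1] := boolP (z.1 \in Omega); have [z2|z2] := boolP (z.2 \in Omega);
    try by case: (_ \in _).
  rewrite memNset// => /(_ _); apply; rewrite notin_setE in z1.
  by rewrite notin_setE in z2.
Qed.

End kernel.

(** * Positivity of the weight *)

Section positivity.
Context (R : realType) (d : nat) (k : 'rV[R]_d -> R).
Hypothesis mk : measurable_fun setT k.
Hypothesis k0 : forall h, 0 <= k h.
Hypothesis ksym : forall h, k (- h) = k h.
Local Notation leb := (@lebesgue_rV R d).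
Local Open Scope ereal_scope.
Hypothesis kpos : forall U, open U -> U !=set0 -> 0 < \int[leb]_(h in U) (k h)%:E.

(** Truncation at height 1 does not change where the kernel vanishes, so the
    truncated kernel charges every open set that the kernel charges. *)
Lemma integral_trunc_kernel_gt0 (U : set 'rV[R]_d) : open U -> U !=set0 ->
  0 < \int[leb]_(h in U) trunc_kernel k h.
Proof.
move=> oU U0; rewrite lt0e; apply/andP; split; last first.
  by apply: integral_ge0 => h _; exact: trunc_kernel_ge0.
apply/eqP => I0; have := kpos oU U0; rewrite lt0e => /andP[/eqP + _]; apply.
have mU := open_measurable_rV oU.
have mt : measurable_fun U (trunc_kernel k).
  by apply: measurable_funTS; exact: measurable_trunc_kernel.
rewrite (@ge0_ae_eq_integral _ _ _ _ U _ (cst 0)) ?integral0//.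
- by apply: measurable_funTS; exact/measurable_EFinP.
- by move=> h _; rewrite lee_fin.
have /(ae_eq_integral_abs leb mU mt) : \int[leb]_(h in U) `|trunc_kernel k h| = 0.
  by rewrite -[RHS]I0; apply: eq_integral => h _; rewrite gee0_abs// trunc_kernel_ge0.
apply: filterS => h /[apply] /=; rewrite /trunc_kernel => -[] /eqP.
by rewrite minEle; case: ifP => [_|_ /eqP ->//]; rewrite oner_eq0.
Qed.

(** For x near x0 the set B - x contains a fixed ball about b - x0; by symmetry
    of the kernel nutilde(x) is its truncated integral over B - x. *)
Lemma nutilde_near_ge (B : set 'rV[R]_d) (x0 : 'rV[R]_d) : open B -> B !=set0 ->
  exists2 c : R, (0 < c)%R & \forall x \near x0, c%:E <= nutilde k B x.
Proof.
move=> oB [b Bb]; have mB := open_measurable_rV oB.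
have [e e0 beB] : exists2 e : R, (0 < e)%R & ball b e `<=` B.
  exact/nbhs_ballP/open_nbhs_nbhs.
have e20 : (0 < e / 2)%R by rewrite divr_gt0.
pose U : set 'rV[R]_d := ball (b - x0)%R (e / 2)%R.
have oU : open U by exact: ball_open.
pose I := \int[leb]_(h in U) trunc_kernel k h.
have I0 : 0 < I by apply: integral_trunc_kernel_gt0 => //; exists (b - x0)%R; exact: ballxx.
have le_nutilde x : ball x0 (e / 2) x -> I <= nutilde k B x.
  move=> x0x; rewrite nutildeE.
  rewrite -(ge0_integral_translate x); last 2 first.
  - apply: emeasurable_funM; first by apply/measurable_EFinP; exact: measurable_indic.
    rewrite (_ : (fun _ => _) = fun y => trunc_kernel k (y - x)).
      exact: measurable_trunc_translate.
    by apply/funext => y; rewrite -(trunc_kernelN ksym) opprB.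
  - by move=> y; apply: mule_ge0; [rewrite lee_fin|exact: trunc_kernel_ge0].
  rewrite /I integral_restrict_indic; apply: ge0_le_integral => //.
  - by move=> h _; apply: mule_ge0; [rewrite lee_fin|exact: trunc_kernel_ge0].
  - apply: emeasurable_funM; last exact: measurable_trunc_kernel.
    by apply/measurable_EFinP; apply: measurable_indic; exact: open_measurable_rV.
  - apply: emeasurable_funM.
      apply/measurable_EFinP; apply: measurableT_comp; first exact: measurable_indic.
      exact: measurable_rV_add.
    rewrite (_ : (fun _ => _) = trunc_kernel k); first exact: measurable_trunc_kernel.
    by apply/funext => y; rewrite opprD addrCA subrr addr0 (trunc_kernelN ksym).
  move=> h _; rewrite opprD addrCA subrr addr0 (trunc_kernelN ksym).
  apply: lee_wpmul2r; first exact: trunc_kernel_ge0.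
  rewrite lee_fin !indicE ler_nat; have [hU|//] := boolP (h \in U).
  rewrite mem_set//; apply: beB; move: hU x0x; rewrite inE /U -!ball_normE /=.
  move=> hU x0x; rewrite (_ : b - _ = (b - x0 - h) + (x0 - x))%R; last first.
    by apply/rowP => i; rewrite !mxE; lra.
  by rewrite [e]splitr (le_lt_trans (ler_normD _ _))// ltrD.
have near_x0 : \forall x \near x0, I <= nutilde k B x.
  by apply/nbhs_ballP; exists (e / 2)%R => //=.
(* I may be infinite, and then any positive constant will do *)
case: I I0 near_x0 {le_nutilde} => [c|_|//]; first by exists c.
move=> H; exists 1%R => //; apply: filterS H => x; apply: le_trans; exact: leey.
Qed.

(** Compactness in near-covering form: the local lower bounds hold for all small
    enough constants c, hence one c serves a whole closed ball. *)
Lemma nutilde_bounded_ge (B A : set 'rV[R]_d) : open B -> B !=set0 -> bounded_set A ->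
  exists2 c : R, (0 < c)%R & forall x, A x -> c%:E <= nutilde k B x.
Proof.
move=> oB B0 bA.
have [N [_ AN]] := bA.
pose r := Num.max 1%R (N + 1)%R.
have r0 : (0 < r)%R by rewrite lt_max ltr01.
have /compact_near_coveringP cK : compact (closed_ball (0%R : 'rV[R]_d) r).
  apply: bounded_closed_compact; last exact: closed_ball_closed.
  exists r; split; first exact: num_real.
  move=> M rM y; rewrite closed_ballE// /closed_ball_/= sub0r normrN.
  by move=> /le_trans; apply; exact: ltW.
have : \forall c \near (0 : R)^'+, closed_ball (0%R : 'rV[R]_d) r `<=`
    [set x | c%:E <= nutilde k B x].
  apply: cK => x _; have [c c0 cx] := nutilde_near_ge x oB B0.
  exists ([set x | c%:E <= nutilde k B x], [set c' | c' <= c]%R) => /=.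
    by split => //; exact: nbhs_right_le.
  by move=> [x' c'] /= [cx' cc']; apply: le_trans cx'; rewrite lee_fin.
move=> cA; near (0 : R)^'+ => c; exists c => // x Ax.
have : closed_ball (0%R : 'rV[R]_d) r `<=` [set x | c%:E <= nutilde k B x].
  by near: c.
apply; rewrite closed_ballE// /closed_ball_/= sub0r normrN.
by apply: AN => //; rewrite lt_max ltrDl ltr01 orbT.
Unshelve. all: by end_near. Qed.

End positivity.

(** * Functions that vanish almost everywhere *)

Section null_functions.
Context (R : realType) (d : nat).
Local Notation leb := (@lebesgue_rV R d).
Local Open Scope ereal_scope.

Lemma weighted_eq0_ae (r : R) (w : 'rV[R]_d -> \bar R) (u : 'rV[R]_d -> R) :
  (0 < r)%R -> measurable_fun setT w -> (forall x, 0 < w x) -> measurable_fun setT u ->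
  \int[leb]_x ((`|u x| `^ r)%:E * w x) = 0 -> \forall x \ae leb, u x = 0%R.
Proof.
move=> r0 mw w0 mu I0.
have mf : measurable_fun setT (fun x => (`|u x| `^ r)%:E * w x).
  apply: emeasurable_funM => //; apply/measurable_EFinP.
  by apply: (measurableT_comp (measurable_powR r)); exact: measurableT_comp.
have /(ae_eq_integral_abs leb measurableT mf) :
    \int[leb]_x `|(`|u x| `^ r)%:E * w x| = 0.
  rewrite -[RHS]I0; apply: eq_integral => x _; rewrite gee0_abs// mule_ge0 ?lee_fin ?powR_ge0//.
  exact: ltW.
apply: filterS => x /(_ I)/eqP; rewrite mule_eq0 (gt_eqF (w0 x)) orbF => /eqP[].
by move=> /eqP; rewrite powR_eq0 normr_eq0 => /andP[/eqP].
Qed.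

Lemma ae0_L2_norm2 (Omega : set 'rV[R]_d) (u : 'rV[R]_d -> R) :
  measurable Omega -> measurable_fun setT u ->
  (\forall x \ae leb, u x = 0%R) -> L2_norm2 Omega u = 0.
Proof.
move=> mO mu u0; rewrite /L2_norm2 (@ge0_ae_eq_integral _ _ _ _ Omega _ (cst 0)) ?integral0//.
  apply: measurable_funTS; apply/measurable_EFinP; apply: measurable_funX.
  exact: measurableT_comp.
by apply: filterS u0 => x -> _; rewrite normr0 expr0n.
Qed.

Lemma ae0_V_seminorm2 (k : 'rV[R]_d -> R) (Omega : set 'rV[R]_d) (u : 'rV[R]_d -> R) :
  measurable_fun setT k -> (forall h, 0 <= k h)%R ->
  measurable Omega -> measurable_fun setT u ->
  (\forall x \ae leb, u x = 0%R) -> V_seminorm2 k Omega u = 0.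
Proof.
move=> mk k0 mO mu u0.
have mE := measurable_energy mk mu.
rewrite /V_seminorm2 (@ge0_ae_eq_integral _ _ _ _ Omega _ (cst 0)) ?integral0//.
- apply: measurable_funTS; apply: (measurable_fun_fubini_tonelli_F _ mE).
  exact: energy_ge0.
- by move=> x _; apply: integral_ge0 => y _; exact: (energy_ge0 k0 u (x, y)).
apply: filterS (u0) => x ux _.
rewrite (@ge0_ae_eq_integral _ _ _ _ setT _ (cst 0)) ?integral0//.
- exact: (measurableT_comp mE (measurable_pair1 x)).
- by move=> y _; exact: (energy_ge0 k0 u (x, y)).
by apply: filterS u0 => y uy _ /=; rewrite ux uy subrr expr0n mul0r.
Qed.

Lemma L2_norm2_le_weighted (c : R) (w : 'rV[R]_d -> \bar R) (A : set 'rV[R]_d)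
    (u : 'rV[R]_d -> R) : (0 < c)%R -> measurable A -> measurable_fun setT w ->
  measurable_fun setT u -> (forall x, A x -> c%:E <= w x) ->
  L2_norm2 A u <= (c^-1)%:E * \int[leb]_(x in A) ((`|u x| ^+ 2)%:E * w x).
Proof.
move=> c0 mA mw mu cw; rewrite lee_pdivlMl//.
have mu2 : measurable_fun setT (fun x => (`|u x| ^+ 2)%:E).
  by apply/measurable_EFinP; apply: measurable_funX; exact: measurableT_comp.
rewrite -ge0_integralZl//; [|exact: measurable_funTS|by rewrite lee_fin ltW].
apply: ge0_le_integral => //.
- by move=> x _; rewrite mule_ge0// lee_fin// ltW.
- by apply: measurable_funTS; exact: measurable_funeM.
- by apply: measurable_funTS; exact: emeasurable_funM.
- by move=> x Ax; rewrite muleC; apply: lee_wpmul2l; [rewrite lee_fin|exact: cw].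
Qed.

End null_functions.

(** * Removing the value of the density at the origin *)

Section punctured_density.
Context (R : realType) (d : nat) (nu : 'rV[R]_d -> R).
Hypothesis hnu : symmetric_levy_density nu.
Local Notation leb := (@lebesgue_rV R d).

Definition punctured : 'rV[R]_d -> R := nu \_ [set~ 0].

Lemma puncturedE h : h != 0 -> punctured h = nu h.
Proof. by move=> h0; rewrite /punctured patchE mem_set//; exact/eqP. Qed.

Lemma punctured0 : punctured 0 = 0.
Proof. by rewrite /punctured patchE memNset//=; apply. Qed.

Lemma measurable_punctured : measurable_fun setT punctured.
Proof.
apply/(measurable_restrictT _ _).1; last exact: levy_measurable.
by apply: measurableC; exact: measurable_rV_set1.
Qed.

Lemma punctured_ge0 h : 0 <= punctured h.
Proof.
have [->|h0] := eqVneq h 0; first by rewrite punctured0.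
by rewrite puncturedE//; exact: levy_ge0.
Qed.

Lemma puncturedN h : punctured (- h) = punctured h.
Proof.
have [->|h0] := eqVneq h 0; first by rewrite oppr0.
by rewrite !puncturedE ?oppr_eq0// -levy_sym.
Qed.

(** On the diagonal both sides vanish because of the difference of values of u,
    whatever nu is at the origin. *)
Lemma energy_punctured (u : 'rV[R]_d -> R) x y :
  (u x - u y) ^+ 2 * nu (x - y) = (u x - u y) ^+ 2 * punctured (x - y).
Proof.
have [->|xy] := eqVneq x y; first by rewrite subrr expr0n !mul0r.
by rewrite puncturedE// subr_eq0.
Qed.

Lemma V_seminorm2_punctured Omega u :
  V_seminorm2 nu Omega u = V_seminorm2 punctured Omega u.
Proof.
by apply: eq_integral => x _; apply: eq_integral => y _; rewrite energy_punctured.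
Qed.

Lemma offdiag_energy_punctured Omega u :
  offdiag_energy nu Omega u = offdiag_energy punctured Omega u.
Proof. by apply: eq_integral => z _; rewrite energy_punctured. Qed.

Lemma measurable_levy : measurable_fun setT nu.
Proof.
rewrite (_ : nu = fun h => punctured h + nu 0 * \1_[set 0] h).
  apply: measurable_funD; first exact: measurable_punctured.
  by apply: measurable_funM => //; apply: measurable_indic; exact: measurable_rV_set1.
apply/funext => h; rewrite indicE; have [->|h0] := eqVneq h 0.
  by rewrite punctured0 mem_set// mulr1 add0r.
by rewrite puncturedE// memNset ?mulr0 ?addr0//; exact/eqP.
Qed.

(** The two integrands differ at y = x only, a null set in positive dimension. *)
Lemma nutilde_punctured B : (0 < d)%N -> measurable B ->
  nutilde nu B = nutilde punctured B.
Proof.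
move=> d0 mB; apply/funext => x.
have mB' (f : 'rV[R]_d -> R) : measurable_fun setT f ->
    measurable_fun B (fun y => (Num.min 1 (f (x - y)))%:E).
  move=> mf; apply: measurable_funTS; apply/measurable_EFinP.
  apply: measurable_minr => //; apply: (measurableT_comp mf).
  exact: (measurableT_comp (@measurable_rV_sub R d) (measurable_pair1 x)).
apply: ae_eq_integral => //.
- exact: (mB' nu measurable_levy).
- exact: (mB' _ measurable_punctured).
exists [set x]; split; [exact: measurable_rV_set1|exact: lebesgue_rV_set1|].
move=> y /=; apply: contra_notP => /eqP xy _.
by rewrite puncturedE// subr_eq0 eq_sym.
Qed.

Lemma integral_punctured (U : set 'rV[R]_d) :
  (\int[leb]_(h in U) (punctured h)%:E = density_measure nu U)%E.
Proof.
rewrite /density_measure setDE [RHS]integral_mkcondr.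
apply: eq_integral => h _; by rewrite /punctured !patchE; case: ifP.
Qed.

Lemma integral_punctured_gt0 (U : set 'rV[R]_d) : full_support nu ->
  open U -> U !=set0 -> (0 < \int[leb]_(h in U) (punctured h)%:E)%E.
Proof.
move=> fs oU [x Ux]; rewrite integral_punctured.
by have : [set: 'rV[R]_d] x by []; rewrite -fs => /(_ U oU Ux).
Qed.

Lemma enorm2E (h : 'rV[R]_d) : enorm h ^+ 2 = \sum_i h ord0 i ^+ 2.
Proof. by rewrite sqr_sqrtr// sumr_ge0// => i _; rewrite sqr_ge0. Qed.

(** The ball is that of the sup norm, whose volume is that of a box; the Euclidean
    norm dominates the sup norm. *)
Lemma enorm2_ge1 (h : 'rV[R]_d) : ~ ball 0 1 h -> 1 <= enorm h ^+ 2.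
Proof.
rewrite -ball_normE /= sub0r normrN => /negP; rewrite -leNgt.
rewrite {1}/Num.Def.normr /= mx_normrE => /bigmax_geP[|[[i j] _ /=]]; first by rewrite ler10.
rewrite (ord1 i) => h1; rewrite enorm2E (bigD1 j)//=.
rewrite -[1]addr0 lerD//; last by apply: sumr_ge0 => ? _; rewrite sqr_ge0.
by rewrite -real_normK ?num_real// -[1](expr1n _ 2) lerXn2r// nnegrE.
Qed.

(** The truncated density is at most 1 on the unit ball, and at most
    (1 /\ |h|^2) nu(h) elsewhere. *)
Lemma trunc_mass_lty : (trunc_mass punctured < +oo)%E.
Proof.
pose U : set 'rV[R]_d := ball 0 1.
have mU : measurable U by apply: open_measurable_rV; exact: ball_open.
pose g h : \bar R := (Num.min 1 (enorm h ^+ 2) * punctured h)%:E.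
have g0 h : (0 <= g h)%E.
  by rewrite lee_fin mulr_ge0 ?punctured_ge0// le_min ler01 sqr_ge0.
have mg : measurable_fun setT g.
  apply/measurable_EFinP; apply: measurable_funM; last exact: measurable_punctured.
  apply: measurable_minr => //; under eq_fun do rewrite enorm2E.
  by apply: measurable_sum => i; apply: measurable_funX; exact: measurable_rV_coord.
have g_lty : (\int[leb]_h g h < +oo)%E.
  apply: le_lt_trans (levy_integrable hnu); rewrite [leRHS]integral_mkcond.
  rewrite le_eqVlt; apply/orP; left; apply/eqP; apply: eq_integral => h _.
  by rewrite /g /punctured !patchE; case: ifP => //; rewrite mulr0.
apply: (@le_lt_trans _ _ (\int[leb]_h ((\1_U h)%:E + g h))%E).
  apply: ge0_le_integral => //.
  - by move=> h _; apply: trunc_kernel_ge0; exact: punctured_ge0.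
  - by apply: measurable_trunc_kernel; exact: measurable_punctured.
  - by apply: emeasurable_funD => //; apply/measurable_EFinP; exact: measurable_indic.
  move=> h _; rewrite /trunc_kernel -EFinD lee_fin indicE.
  have [hU|hU] := boolP (h \in U).
    apply: (@le_trans _ _ 1); first by rewrite ge_min lexx.
    by rewrite lerDl -lee_fin; exact: g0.
  have h1 : 1 <= enorm h ^+ 2 by apply: enorm2_ge1; rewrite notin_setE in hU.
  by rewrite add0r (min_idPl h1) mul1r ge_min lexx orbT.
rewrite ge0_integralD//; last by apply/measurable_EFinP; exact: measurable_indic.
rewrite integral_indic// setIT lte_add_pinfty//.
apply: lebesgue_rV_bounded => //.
exists 1; split; first exact: num_real.
move=> M M1 y; rewrite /U -ball_normE /= sub0r normrN => y1.
by apply: ltW; exact: lt_trans M1.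
Qed.

End punctured_density.

(** * Comparison of norms *)

Section norm_comparison.
Context (R : realType).
Local Open Scope ereal_scope.

Lemma sqrte_lty (x : \bar R) : x < +oo -> sqrte x < +oo.
Proof. by case: x => //= r _; rewrite ltry. Qed.

Lemma sqrte_le_scale (a : R) (x y : \bar R) : (0 <= a)%R -> 0 <= y ->
  x <= a%:E * y -> sqrte x <= (Num.sqrt a)%:E * sqrte y.
Proof.
move=> a0 y0 xy; rewrite (_ : (Num.sqrt a)%:E = sqrte a%:E)//.
by rewrite -sqrteM ?lee_fin// lee_sqrt// mule_ge0// lee_fin.
Qed.

(** Bookkeeping for the constants in the norm equivalences. *)
Lemma lee_lincomb (a b c : R) (x y : \bar R) : (0 <= a <= c)%R -> (0 <= b <= c)%R ->
  0 <= x -> 0 <= y -> a%:E * x + b%:E * y <= c%:E * (x + y).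
Proof.
move=> /andP[a0 ac] /andP[b0 bc] x0 y0; rewrite ge0_muleDr//.
by apply: leeD; apply: lee_wpmul2r; rewrite // lee_fin.
Qed.

(** The estimates are proved for squared norms; constants become square roots.
    Finiteness of G follows from that of F. *)
Lemma equivalent_norms_sqrte (X : Type) (E : set X) (F G : X -> \bar R) (a b : R) :
  (0 < a)%R -> (0 < b)%R ->
  (forall u, E u -> [/\ 0 <= F u, 0 <= G u, F u < +oo, F u <= a%:E * G u
     & G u <= b%:E * F u]) ->
  equivalent_norms E (fun u => sqrte (F u)) (fun u => sqrte (G u)).
Proof.
move=> a0 b0 H; split.
  move=> u /H[F0 G0 Foo _ GF].
  split; apply: sqrte_lty => //; apply: (le_lt_trans GF).
  by rewrite lte_mul_pinfty// lee_fin ltW.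
exists (Num.sqrt a)^-1%R, (Num.sqrt b); split; rewrite ?invr_gt0 ?sqrtr_gt0//.
move=> u /H[F0 G0 Foo FG GF]; split; last by apply: sqrte_le_scale => //; exact: ltW.
by rewrite lee_pdivrMl ?sqrtr_gt0//; apply: sqrte_le_scale => //; exact: ltW.
Qed.

Context (d : nat).
Local Notation leb := (@lebesgue_rV R d).

Lemma wLp_norm2E (w : 'rV[R]_d -> \bar R) (u : 'rV[R]_d -> R) : (forall x, 0 <= w x) ->
  wLp_norm 2 w u = sqrte (\int[leb]_x ((`|u x| ^+ 2)%:E * w x)).
Proof.
move=> w0; rewrite /wLp_norm; under eq_integral do rewrite powR_mulrn//.
by rewrite poweR12_sqrt//; apply: integral_ge0 => x _; rewrite mule_ge0// lee_fin.
Qed.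

Lemma wLp_norm1E (w : 'rV[R]_d -> \bar R) (u : 'rV[R]_d -> R) : (forall x, 0 <= w x) ->
  wLp_norm 1 w u = \int[leb]_x (`|u x|%:E * w x).
Proof.
move=> w0; rewrite /wLp_norm; under eq_integral do rewrite powRr1//.
by rewrite invr1 poweRe1//; apply: integral_ge0 => x _; rewrite mule_ge0// lee_fin.
Qed.

(** Cauchy-Schwarz for the factors |u| sqrt(w) and sqrt(w); finiteness of w
    makes them real-valued. *)
Lemma wLp_norm1_le2 (w : 'rV[R]_d -> \bar R) (u : 'rV[R]_d -> R) :
  measurable_fun setT w -> (forall x, 0 <= w x < +oo) -> measurable_fun setT u ->
  wLp_norm 1 w u <= sqrte (\int[leb]_x w x) * wLp_norm 2 w u.
Proof.
move=> mw w0 mu; have w00 x : 0 <= w x by have /andP[] := w0 x.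
have wfin x : w x = (fine (w x))%:E.
  by rewrite fineK// ge0_fin_numE//; have /andP[] := w0 x.
have fw0 x : (0 <= fine (w x))%R by exact: fine_ge0.
pose g x := Num.sqrt (fine (w x)).
pose f x := (`|u x| * g x)%R.
have mg : measurable_fun setT g.
  apply: measurableT_comp; last by apply: measurableT_comp => //; exact: fine_measurable.
  by apply: continuous_measurable_fun; exact: sqrt_continuous.
have mf : measurable_fun setT f.
  by apply: measurable_funM => //; exact: measurableT_comp.
have N2 (h : 'rV[R]_d -> R) :
    'N[leb]_(2%:E)[EFin \o h] = sqrte (\int[leb]_x (h x ^+ 2)%:E).
  rewrite unlock /= poweR12_sqrt; last by apply: integral_ge0 => x _; rewrite lee_fin powR_ge0.
  congr sqrte; apply: eq_integral => x _.
  by rewrite /= powR_mulrn// real_normK ?num_real.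
have -> : wLp_norm 1 w u = 'N[leb]_1[EFin \o (f \* g)%R].
  rewrite Lnorm1 wLp_norm1E//; apply: eq_integral => x _; rewrite wfin -EFinM /=.
  by rewrite -mulrA -expr2 sqr_sqrtr// normrM normr_id (ger0_norm (fw0 x)).
have -> : wLp_norm 2 w u = 'N[leb]_(2%:E)[EFin \o f].
  rewrite N2 wLp_norm2E//; congr sqrte; apply: eq_integral => x _.
  by rewrite wfin -EFinM exprMn sqr_sqrtr.
have -> : sqrte (\int[leb]_x w x) = 'N[leb]_(2%:E)[EFin \o g].
  by rewrite N2; congr sqrte; apply: eq_integral => x _; rewrite wfin sqr_sqrtr.
by rewrite muleC; apply: hoelder => //; lra.
Qed.

End norm_comparison.

(** * The weight and the norms of a Lévy density *)

Section nonlocal_norms.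
Context (R : realType) (d : nat) (nu : 'rV[R]_d -> R) (Omega B : set 'rV[R]_d).
Hypotheses (d0 : (0 < d)%N) (hnu : symmetric_levy_density nu).
Hypothesis hfull : full_support nu.
Hypotheses (oOmega : open Omega) (oB : open B) (BOmega : B `<=` Omega) (B0 : B !=set0).
Local Notation leb := (@lebesgue_rV R d).
Local Notation w := (nutilde nu B).
Local Notation mass := (trunc_mass (punctured nu)).
Implicit Types u : 'rV[R]_d -> R.
Local Open Scope ereal_scope.

Let mB : measurable B := open_measurable_rV oB.
Let mOmega : measurable Omega := open_measurable_rV oOmega.
Let k0 := punctured_ge0 hnu.
Let kN := puncturedN hnu.
Let mk := measurable_punctured hnu.
Let wE : w = nutilde (punctured nu) B := nutilde_punctured hnu d0 mB.

Let mw : measurable_fun setT w.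
Proof. by rewrite wE; exact: measurable_nutilde. Qed.

Let w0 x : 0 <= w x.
Proof. by rewrite wE; exact: nutilde_ge0. Qed.

Let w_le x : w x <= mass.
Proof. by rewrite wE; exact: nutilde_le_mass. Qed.

Let mass_fin : mass \is a fin_num.
Proof.
rewrite ge0_fin_numE; first exact: trunc_mass_lty.
by apply: integral_ge0 => h _; exact: trunc_kernel_ge0.
Qed.

Let M := fine mass.
Let massE : mass = M%:E. Proof. by rewrite fineK. Qed.
Let M0 : (0 <= M)%R.
Proof.
by apply: fine_ge0; apply: integral_ge0 => h _; exact: trunc_kernel_ge0.
Qed.

Let w_bounded_ge A : bounded_set A ->
  exists2 c : R, (0 < c)%R & forall x, A x -> c%:E <= w x.
Proof.
rewrite wE; apply: nutilde_bounded_ge => // U.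
exact: integral_punctured_gt0.
Qed.

Let w_gt0 x : 0 < w x.
Proof.
have [|c c0 /(_ x erefl)] := @w_bounded_ge [set x].
  exists `|x|%R; split; first exact: num_real.
  by move=> r xr y ->; exact: ltW.
by apply: lt_le_trans; rewrite lte_fin.
Qed.

Let integral_w : \int[leb]_x w x = leb B * M%:E.
Proof. by rewrite wE integral_nutilde// massE. Qed.

Let integral_w_lty : leb B < +oo -> \int[leb]_x w x < +oo.
Proof. by move=> lB; rewrite integral_w muleC lte_mul_pinfty. Qed.

Let weighted u := \int[leb]_x ((`|u x| ^+ 2)%:E * w x).
Let weighted_on (A : set 'rV[R]_d) u := \int[leb]_(x in A) ((`|u x| ^+ 2)%:E * w x).

Let weighted_on_ge0 A u : 0 <= weighted_on A u.
Proof. by apply: integral_ge0 => x _; rewrite mule_ge0// lee_fin. Qed.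

Let weighted_ge0 u : 0 <= weighted u.
Proof. by apply: integral_ge0 => x _; rewrite mule_ge0// lee_fin. Qed.

Let L2_ge0 A u : 0 <= L2_norm2 A u.
Proof. by apply: integral_ge0 => x _; rewrite lee_fin. Qed.

Let V_ge0 A u : 0 <= V_seminorm2 nu A u.
Proof.
rewrite V_seminorm2_punctured//; apply: integral_ge0 => x _.
by apply: integral_ge0 => y _; exact: (energy_ge0 k0 u (x, y)).
Qed.

Let offdiag_ge0 u : 0 <= offdiag_energy nu Omega u.
Proof.
by rewrite offdiag_energy_punctured//; apply: integral_ge0 => z _; exact: energy_ge0.
Qed.

Let measurable_weighted u : measurable_fun setT u ->
  measurable_fun setT (fun x => (`|u x| ^+ 2)%:E * w x).
Proof.
move=> mu; apply: emeasurable_funM => //; apply/measurable_EFinP.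
by apply: measurable_funX; exact: measurableT_comp.
Qed.

Let weighted_on_le A A' u : measurable_fun setT u -> measurable A -> measurable A' ->
  A `<=` A' -> weighted_on A u <= weighted_on A' u.
Proof.
move=> mu mA mA' AA'; apply: ge0_subset_integral => //.
  by apply: measurable_funTS; exact: measurable_weighted.
by move=> x _; rewrite mule_ge0// lee_fin.
Qed.

Let V_B_le u : measurable_fun setT u -> V_seminorm2 nu B u <= V_seminorm2 nu Omega u.
Proof.
move=> mu; rewrite !(V_seminorm2_punctured nu); apply: ge0_subset_integral => //.
  apply: measurable_funTS; apply: (measurable_fun_fubini_tonelli_F _ (measurable_energy mk mu)).
  exact: energy_ge0.
by move=> x _; apply: integral_ge0 => y _; exact: (energy_ge0 k0 u (x, y)).
Qed.

Let L2_B_le u : measurable_fun setT u -> L2_norm2 B u <= L2_norm2 Omega u.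
Proof.
move=> mu; apply: ge0_subset_integral => //.
apply: measurable_funTS; apply/measurable_EFinP; apply: measurable_funX.
exact: measurableT_comp.
Qed.

Let weighted_le_B u : measurable_fun setT u ->
  weighted u <= (2 * M)%:E * L2_norm2 B u + 2%:E * V_seminorm2 nu B u.
Proof.
move=> mu; rewrite /weighted wE V_seminorm2_punctured//.
apply: (le_trans (weighted_L2_le mk k0 kN mu mB)); rewrite massE.
rewrite ge0_muleDr ?mule_ge0 ?lee_fin//; last by rewrite -V_seminorm2_punctured.
by rewrite EFinM [L2_norm2 B u * _]muleC muleA.
Qed.

Let weighted_le u : measurable_fun setT u ->
  weighted u <= (2 * M + 2)%:E * (L2_norm2 Omega u + V_seminorm2 nu Omega u).
Proof.
move=> mu; apply: (le_trans (weighted_le_B mu)).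
apply: (@le_trans _ _ ((2 * M)%:E * L2_norm2 Omega u + 2%:E * V_seminorm2 nu Omega u)).
  apply: leeD; apply: lee_wpmul2l; rewrite ?lee_fin ?mulr_ge0//.
  - exact: L2_B_le.
  - exact: V_B_le.
by apply: lee_lincomb => //; have := M0; lra.
Qed.

Lemma nutilde_Loo : mem_Lp +oo%E w.
Proof.
split; first exact: mw.
rewrite unlock; case: ifPn => _; last exact: ltry.
apply: (@le_lt_trans _ _ mass); last by rewrite massE ltry.
by apply/ess_supP; apply/nearW => x /=; rewrite gee0_abs.
Qed.

Lemma nutilde_L1 : leb B < +oo -> mem_Lp 1%E w.
Proof.
move=> lB; split; first exact: mw.
rewrite Lnorm1 (eq_integral w); first exact: integral_w_lty.
by move=> x _; rewrite gee0_abs.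
Qed.

Let V_measurable u : V_space nu Omega u -> measurable_fun setT u.
Proof. by case. Qed.

Let V_norm2_lty u : V_space nu Omega u -> L2_norm2 Omega u + V_seminorm2 nu Omega u < +oo.
Proof. by case=> _ L V; rewrite lte_add_pinfty. Qed.

(** The norm bound is the main estimate; injectivity on classes holds because
    the weight is everywhere positive. *)
Lemma V_space_embeds_L2 :
  continuous_embedding (V_space nu Omega) (V_norm nu Omega)
    (wLp_space 2 w) (wLp_norm 2 w).
Proof.
have norm_le u : V_space nu Omega u ->
    wLp_norm 2 w u <= (Num.sqrt (2 * M + 2))%:E * V_norm nu Omega u.
  move=> Vu; rewrite wLp_norm2E//; apply: sqrte_le_scale.
  - by rewrite addr_ge0// mulr_ge0.
  - exact: adde_ge0.
  - by apply: weighted_le; exact: V_measurable.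
have C0 : (0 < Num.sqrt (2 * M + 2))%R by rewrite sqrtr_gt0 ltr_wpDl// mulr_ge0.
split.
- move=> u Vu; split; first exact: V_measurable.
  apply: (le_lt_trans (norm_le u Vu)); rewrite lte_mul_pinfty ?lee_fin ?ltW//.
  exact/sqrte_lty/V_norm2_lty.
- move=> u Vu /eqP; rewrite /wLp_norm poweR_eq0; last first.
    by apply: integral_ge0 => x _; rewrite mule_ge0// lee_fin powR_ge0.
  move=> /andP[/eqP I0 _].
  have u0 : \forall x \ae leb, u x = 0%R.
    by apply: (weighted_eq0_ae _ mw w_gt0 (V_measurable Vu) I0).
  have mu := V_measurable Vu.
  rewrite /V_norm V_seminorm2_punctured// ae0_L2_norm2// ae0_V_seminorm2//.
  by rewrite adde0 sqrte0.
by exists (Num.sqrt (2 * M + 2)).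
Qed.

Lemma L2_embeds_L1 : leb B < +oo ->
  continuous_embedding (wLp_space 2 w) (wLp_norm 2 w) (wLp_space 1 w) (wLp_norm 1 w).
Proof.
move=> lB.
have wlty x : 0 <= w x < +oo.
  by rewrite w0/=; apply: (le_lt_trans (w_le x)); rewrite massE ltry.
pose N := fine (\int[leb]_x w x).
have NE : \int[leb]_x w x = N%:E.
  by rewrite fineK// ge0_fin_numE ?integral_w_lty//; apply: integral_ge0.
have norm_le u : measurable_fun setT u ->
    wLp_norm 1 w u <= (Num.sqrt N + 1)%:E * wLp_norm 2 w u.
  move=> mu; apply: (le_trans (wLp_norm1_le2 mw wlty mu)).
  apply: lee_wpmul2r; first exact: poweR_ge0.
  by rewrite NE lee_fin lerDl.
have C0 : (0 < Num.sqrt N + 1)%R by rewrite ltr_wpDl// sqrtr_ge0.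
split.
- move=> u [mu u2]; split=> //; apply: (le_lt_trans (norm_le u mu)).
  by rewrite lte_mul_pinfty// lee_fin ltW.
- move=> u [mu _]; rewrite /wLp_norm => /eqP; rewrite poweR_eq0; last first.
    by apply: integral_ge0 => x _; rewrite mule_ge0// lee_fin powR_ge0.
  move=> /andP[/eqP I0 _].
  have u0 : \forall x \ae leb, u x = 0%R by exact: (weighted_eq0_ae _ mw w_gt0 mu I0).
  have -> : \int[leb]_x ((`|u x| `^ 2)%:E * w x) = 0.
    rewrite (@ge0_ae_eq_integral _ _ _ _ setT _ (cst 0)) ?integral0//.
    - apply: emeasurable_funM => //; apply/measurable_EFinP.
      by apply: (measurableT_comp (measurable_powR _)); exact: measurableT_comp.
    - by move=> x _; rewrite mule_ge0// lee_fin powR_ge0.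
    by apply: filterS u0 => x -> _; rewrite normr0 powR0// mul0e.
  by rewrite poweR0r// invr_eq0.
by exists (Num.sqrt N + 1)%R => // u [mu _]; exact: norm_le.
Qed.

Let offdiag_le u : measurable_fun setT u ->
  offdiag_energy nu Omega u <= 2%:E * V_seminorm2 nu Omega u.
Proof.
move=> mu; rewrite offdiag_energy_punctured// V_seminorm2_punctured//.
exact: offdiag_le_V_seminorm2.
Qed.

Let V_le_offdiag u : measurable_fun setT u ->
  V_seminorm2 nu Omega u <= offdiag_energy nu Omega u.
Proof.
move=> mu; rewrite offdiag_energy_punctured// V_seminorm2_punctured//.
exact: V_seminorm2_le_offdiag.
Qed.

Let star2_le u : measurable_fun setT u -> weighted u + offdiag_energy nu Omega u <=
  (2 * M + 4)%:E * (L2_norm2 Omega u + V_seminorm2 nu Omega u).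
Proof.
move=> mu; apply: (le_trans (leeD (weighted_le mu) (offdiag_le mu))).
rewrite (_ : 2 * M + 4 = (2 * M + 2) + 2)%R; last by lra.
rewrite [(2 * M + 2 + 2)%:E]EFinD [leRHS]ge0_muleDl ?lee_fin//; last by rewrite addr_ge0// mulr_ge0.
apply: leeD => //; apply: lee_wpmul2l => //; exact: leeDr.
Qed.

(** Only the part of the weighted norm outside Omega must be recovered.  The main
    estimate bounds the whole weighted norm by the L^2 norm on B and the energy,
    and on the bounded set B the weight is bounded below, so that this L^2 norm is
    controlled by the weighted norm over Omega, which contains B. *)
Lemma sharp_star_equivalent : bounded_set B ->
  equivalent_norms (V_space nu Omega) (sharp_norm nu B Omega) (star_norm nu B Omega).
Proof.
move=> /w_bounded_ge[c c0 cw].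
apply: (@equivalent_norms_sqrte _ _ _
  (fun u => weighted_on Omega u + offdiag_energy nu Omega u)
  (fun u => weighted u + offdiag_energy nu Omega u) 1 (2 * M * c^-1 + 3)) => //.
  by rewrite ltr_wpDl// !mulr_ge0// invr_ge0 ltW.
move=> u Vu; have mu := V_measurable Vu.
have on_le : weighted_on Omega u <= weighted u by exact: weighted_on_le.
have sharp_le_star : weighted_on Omega u + offdiag_energy nu Omega u <=
    weighted u + offdiag_energy nu Omega u by exact: leeD.
split.
- exact: adde_ge0.
- exact: adde_ge0.
- apply: (le_lt_trans sharp_le_star); apply: (le_lt_trans (star2_le mu)).
  rewrite lte_mul_pinfty//; last exact: V_norm2_lty.
  by rewrite lee_fin addr_ge0// mulr_ge0.
- by rewrite mul1e.
have L2B : (2 * M)%:E * L2_norm2 B u <= (2 * M * c^-1)%:E * weighted_on Omega u.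
  rewrite [(2 * M * c^-1)%:E]EFinM -muleA; apply: lee_wpmul2l; first by rewrite lee_fin mulr_ge0.
  apply: (le_trans (L2_norm2_le_weighted c0 mB mw mu cw)).
  apply: lee_wpmul2l; first by rewrite lee_fin invr_ge0 ltW.
  exact: weighted_on_le.
have VB : 2%:E * V_seminorm2 nu B u <= 2%:E * offdiag_energy nu Omega u.
  apply: lee_wpmul2l => //; apply: (le_trans (V_B_le mu)); exact: V_le_offdiag.
apply: (le_trans (leeD (le_trans (weighted_le_B mu) (leeD L2B VB)) (lexx _))).
rewrite -addeA -[X in _ + (_ + X)]mul1e -ge0_muleDl ?lee_fin// -EFinD.
have c'0 : (0 <= 2 * M * c^-1)%R by rewrite !mulr_ge0// invr_ge0 ltW.
by apply: lee_lincomb => //; lra.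
Qed.

(** On a bounded Omega the weight is bounded below, which controls the unweighted
    L^2 norm; the converse bound is the main estimate. *)
Lemma V_star_equivalent : bounded_set Omega ->
  equivalent_norms (V_space nu Omega) (V_norm nu Omega) (star_norm nu B Omega).
Proof.
move=> /w_bounded_ge[c c0 cw].
apply: (@equivalent_norms_sqrte _ _ _
  (fun u => L2_norm2 Omega u + V_seminorm2 nu Omega u)
  (fun u => weighted u + offdiag_energy nu Omega u) (c^-1 + 1) (2 * M + 4)).
- by rewrite ltr_wpDl// invr_ge0 ltW.
- by rewrite ltr_wpDl// mulr_ge0.
move=> u Vu; have mu := V_measurable Vu; split.
- exact: adde_ge0.
- exact: adde_ge0.
- exact: V_norm2_lty.
- have c'0 : (0 <= c^-1)%R by rewrite invr_ge0 ltW.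
  apply: (@le_trans _ _ (c^-1%:E * weighted u + 1%:E * offdiag_energy nu Omega u)).
    rewrite mul1e; apply: leeD; last exact: V_le_offdiag.
    apply: (le_trans (L2_norm2_le_weighted c0 mOmega mw mu cw)).
    by apply: lee_wpmul2l; [rewrite lee_fin|exact: weighted_on_le].
  by apply: lee_lincomb => //; lra.
- exact: star2_le.
Qed.

End nonlocal_norms.

Theorem lemma2p17 (R : realType) (d : nat) (hd : (0 < d)%N)
    (Omega : set 'rV[R]_d) (hOmega : open Omega)
    (nu : 'rV[R]_d -> R) (hnu : symmetric_levy_density nu)
    (hfull : full_support nu)
    (B : set 'rV[R]_d) (hBOmega : B `<=` Omega) (hB0 : B !=set0)
    (hB : open B) :
  (mem_Lp +oo%E (nutilde nu B) /\
   ((lebesgue_rV B < +oo)%E -> mem_Lp 1%E (nutilde nu B))) /\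
  (continuous_embedding (V_space nu Omega) (V_norm nu Omega)
     (wLp_space 2 (nutilde nu B)) (wLp_norm 2 (nutilde nu B)) /\
   ((lebesgue_rV B < +oo)%E ->
    continuous_embedding
      (wLp_space 2 (nutilde nu B)) (wLp_norm 2 (nutilde nu B))
      (wLp_space 1 (nutilde nu B)) (wLp_norm 1 (nutilde nu B)))) /\
  ((unimodal nu -> bounded_set B ->
    equivalent_norms (V_space nu Omega)
      (sharp_norm nu B Omega) (star_norm nu B Omega)) /\
   (bounded_set Omega ->
    equivalent_norms (V_space nu Omega)
      (V_norm nu Omega) (star_norm nu B Omega))).
Proof.
split; [split|split; [split|split]].
- exact: nutilde_Loo.
- exact: nutilde_L1.
- exact: V_space_embeds_L2.
- exact: L2_embeds_L1.
- by move=> _; exact: sharp_star_equivalent.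
- exact: V_star_equivalent.
Qed.
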